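(* Let $G$ be a finite group and let $V$ be a finite $G$-module of characteristic $p$. Let $v\in V$ and $C=C_G(v)$, and suppose that $(|C|,|V|)=1$. Then the number of irreducible complex characters $\chi$ of the semidirect product $GV$ whose restriction to $\langle v\rangle$ is not an integer multiple of the regular character of $\langle v\rangle$ is at most $$\sum_{i=1}^{k(C)}|C_V(c_i)|,$$ where $c_1,\dots,c_{k(C)}$ are representatives of the conjugacy classes of $C$.
   Context: A finite $G$-module of characteristic $p$ ($p$ a prime) is a finite vector space over a field of characteristic $p$ on which $G$ acts linearly (so $V$ is an elementary abelian $p$-group). $GV$ denotes the semidirect product of $V$ by $G$ with respect to this action; $V$ and $G$ are regarded as subgroups of $GV$, and $\langle v\rangle$ is the cyclic subgroup of $V$ generated by $v$. $C_G(v)$ is the stabilizer of $v$ in $G$, $C_V(c)$ is the set of fixed points of $c$ in $V$, and $k(X)$ is the number of conjugacy classes of a finite group $X$. *)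

(* Defs.v *)
From HB Require Import structures.
From mathcomp Require Import all_boot all_order all_fingroup all_algebra.
From mathcomp Require Import all_solvable all_field all_character.

Set Implicit Arguments.
Unset Strict Implicit.
Unset Printing Implicit Defensive.

Import GroupScope GRing.Theory Num.Theory.
Local Open Scope ring_scope.

(* The row vectors 'rV[F]_n carry their additive finGroupType structure, and G
   acts on them on the right through rG; the type below is the external
   semidirect product for this action. *)
Notation affine_sdprod rG := (sdprod_by (mx_repr_groupAction rG)).

Definition sdvec (F : finFieldType) (gT : finGroupType) (G : {group gT})
    (n : nat) (rG : mx_representation F G n) (v : 'rV[F]_n) :
  affine_sdprod rG := sdpair1 (mx_repr_groupAction rG) v.

(* 'Z[S] is the set of integer linear combinations of S; having a boolean
   predicate here makes it possible to count characters. *)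
Definition cfReg_multiple (gT : finGroupType) (H : {group gT}) (phi : 'CF(H)) :
  bool := phi \in 'Z[[:: cfReg H]].

Lemma cfReg_multipleP (gT : finGroupType) (H : {group gT}) (phi : 'CF(H)) :
  reflect (exists m : int, phi = m%:~R *: cfReg H) (cfReg_multiple phi).
Proof.
rewrite /cfReg_multiple.
have memR: cfReg H \in 'Z[[:: cfReg H]] by rewrite mem_zchar ?mem_head.
apply: (iffP idP) => [/(zchar_nth_expansion (S := [:: cfReg H]))[a Za ->]|[m ->]].
  by have /intrP[m am] := Za ord0; exists m; rewrite big_ord1 am.
by rewrite scaler_int rpredMz.
Qed.

(* Main.v *)
Require Import Defs.
From mathcomp Require Import all_boot all_order all_fingroup all_algebra.
From mathcomp Require Import all_solvable all_field all_character.

(* Let x = v, of prime order p, H = <x>, and let W be the semidirect product.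
   For an irreducible character chi of W, write the restriction of chi to H x C
   as the sum of m(j,k) (lambda_j x psi_k).  Then the sum of |chi(z)|^2 over the
   z in HC outside C is |C| times the sum over k of
     p (sum_j m(j,k)^2) - (sum_j m(j,k))^2 = sum_(j < j') (m(j,k) - m(j',k))^2.
   If chi is not a multiple of the regular character on H, then for some k the
   integers m(j,k) are not all equal, and this expression is at least p - 1.
   Summing over chi, column orthogonality bounds the number of such chi by the
   average over c in C of |C_W(xc)| = |C_W(x) :&: C_W(c)| = |C_C(c)||C_V(c)|,
   where the coprimality of |C| and p is used. *)

Set Implicit Arguments.
Unset Strict Implicit.
Unset Printing Implicit Defensive.

Import GroupScope GRing.Theory.
Local Open Scope ring_scope.
Import Order.TTheory Num.Theory.

(** * Inequalities for sums of squares of integers *)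

Lemma sum_sqr_diff (R : comPzRingType) (J : finType) (f : J -> R) :
  \sum_j \sum_k (f j - f k) ^+ 2
    = (#|J|%:R * \sum_j f j ^+ 2 - (\sum_j f j) ^+ 2) *+ 2.
Proof.
have sq_row j : \sum_k (f j - f k) ^+ 2
    = #|J|%:R * f j ^+ 2 - (f j * \sum_k f k) *+ 2 + \sum_k f k ^+ 2.
  under eq_bigr do rewrite sqrrB.
  rewrite big_split sumrB /= sumr_const -[_ *+ #|J|]mulr_natl.
  by rewrite sumrMnl -mulr_sumr.
under eq_bigr do rewrite sq_row.
rewrite big_split sumrB /= sumr_const -mulr_sumr sumrMnl -mulr_suml -expr2.
by rewrite -[X in _ + X]mulr_natl addrAC -mulr2n mulrnBl.
Qed.

(** Elements of [R] need not be real; integrality makes the squared differences nonnegative. *)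
Lemma sqr_sum_le (R : archiNumDomainType) (J : finType) (f : J -> R)
    (Zf : forall j, f j \is a Num.int) :
  (\sum_j f j) ^+ 2 <= #|J|%:R * \sum_j f j ^+ 2.
Proof.
rewrite -subr_ge0 -(pmulrn_lge0 _ (isT : 0 < 2)%N) -sum_sqr_diff.
apply: sumr_ge0 => j _; apply: sumr_ge0 => k _.
by rewrite real_exprn_even_ge0 ?Rreal_int ?rpredB.
Qed.

(** Distinct integers have squared difference at least 1, so by [sum_sqr_diff] twice the gap is at
    least the number of ordered pairs on which [f] differs. *)
Lemma sqr_sum_le_nonconst (R : archiNumDomainType) (J : finType) (f : J -> R)
    (Zf : forall j, f j \is a Num.int) (a b : J) (ab : f a != f b) :
  #|J|.-1%:R + (\sum_j f j) ^+ 2 <= #|J|%:R * \sum_j f j ^+ 2.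
Proof.
pose A := [set j | f j == f a].
have Aa : a \in A by rewrite inE.
have nAb : b \in ~: A by rewrite !inE eq_sym.
(* A row j of the double sum has at least as many nonzero terms as there are k
   on the other side of the partition of J into A and its complement. *)
have sq_row j : #|if j \in A then ~: A else A|%:R <= \sum_k (f j - f k) ^+ 2.
  rewrite (bigID (fun k => f k == f j)) /= big1 ?add0r => [|k /eqP->]; last first.
    by rewrite subrr expr0n.
  apply: le_trans (_ : \sum_(k | f k != f j) 1 <= _); last first.
    apply: ler_sum => k kj; rewrite sqr_intr_ge1 ?rpredB //.
    by rewrite subr_eq0 eq_sym.
  rewrite sumr_const ler_nat subset_leq_card //; apply/subsetP=> k.
  case: ifP; rewrite !inE => fj fk; rewrite unfold_in /=.
    by rewrite (eqP fj).
  by rewrite (eqP fk) eq_sym fj.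
have := ler_sum (index_enum J) (fun j (_ : true) => sq_row j).
rewrite -natr_sum sum_sqr_diff => le_row.
rewrite -lerBrDr -(ler_pMn2r (isT : 0 < 2)%N); apply: le_trans le_row.
rewrite -mulrnA ler_nat (bigID [in A]) /=.
under eq_bigr => j -> do [].
under [X in (_ <= _ + X)%N]eq_bigr => j /negPf-> do [].
rewrite !sum_nat_const -(cardsC A).
have -> : #|[predC A]| = #|~: A| by apply: eq_card => j; rewrite !inE.
have: (0 < #|A|)%N by apply/card_gt0P; exists a.
have: (0 < #|~: A|)%N by apply/card_gt0P; exists b.
(* With [#|A| = s + 1] and [#|~: A| = t + 1], the claim is [2 (s + t + 1) <= 2 (s + 1) (t + 1)]. *)
case: #|A| => // s; case: #|~: A| => // t _ _.
rewrite (mulnC t.+1) addnn -muln2 leq_mul2r addSn mulSn addnC.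
by rewrite leq_add2l leq_pmulr.
Qed.

(** * Characters of a direct product and their restrictions to the factors *)

Lemma cfnorm_sum_irr (gT : finGroupType) (G : {group gT}) (a : Iirr G -> algC) :
  '[\sum_i a i *: 'chi_i] = \sum_i `|a i| ^+ 2.
Proof.
rewrite cfdot_sum_irr; apply: eq_bigr => i _.
suff -> : '[\sum_j a j *: 'chi_j, 'chi_i] = a i by rewrite normCK.
rewrite cfdot_suml (bigD1 i) //= cfdotZl cfnorm_irr mulr1 big1 ?addr0 // => j ji.
by rewrite cfdotZl cfdot_irr (negPf ji) mulr0.
Qed.

(** Since [H] is abelian, restriction to [K] merges the constituents with the same [k], and the
    multiplicities in row [m k] add up. Then [sqr_sum_le] applies to every row, and a nonconstant
    row gains [#|H|.-1]. *)
Lemma cfnorm_not_cfReg_multiple (gT : finGroupType) (H K D : {group gT})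
    (HxK : H \x K = D) (prH : prime #|H|) (phi : 'CF(D))
    (Nphi : phi \is a character) (nreg : ~~ cfReg_multiple ('Res[H] phi)) :
  #|H|.-1%:R + '['Res[K] phi] <= #|H|%:R * '[phi].
Proof.
pose m k j := '[phi, 'chi_(dprod_Iirr HxK (j, k))].
have Nm k j : m k j \is a Num.nat by apply: Cnat_cfdot_char_irr.
have Zm k j : m k j \is a Num.int by apply: intr_nat.
have abH : abelian H by rewrite cyclic_abelian ?prime_cyclic.
have chi1 (j : Iirr H) : 'chi_j 1%g = 1 by apply/lin_char1/char_abelianP.
have bij_dp : {on [pred i | true], bijective (dprod_Iirr HxK)}.
  exists (inv_dprod_Iirr HxK) => x _; first exact: dprod_IirrK.
  exact: inv_dprod_IirrK.
have phiE : phi = \sum_k \sum_j m k j *: cfDprod HxK 'chi_j 'chi_k.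
  rewrite {1}[phi]cfun_sum_cfdot (reindex _ bij_dp) exchange_big pair_big /=.
  by apply: eq_bigr => -[j k] _; rewrite -dprod_IirrE.
have norm_phi : '[phi] = \sum_k \sum_j m k j ^+ 2.
  rewrite cfdot_sum_irr (reindex _ bij_dp) exchange_big pair_big /=.
  by apply: eq_bigr => -[j k] _; rewrite (conj_natr (Nm k j)) -expr2.
have normK : '['Res[K] phi] = \sum_k (\sum_j m k j) ^+ 2.
  rewrite phiE linear_sum /=.
  under eq_bigr => k _.
    rewrite linear_sum.
    under eq_bigr do rewrite linearZ /= cfDprod_Resr chi1 scale1r.
    rewrite -scaler_suml; over.
  rewrite cfnorm_sum_irr; apply: eq_bigr => k _.
  by rewrite natr_normK // rpred_sum.
(* If every row were constant, the restriction to [H] would be a multiple of the sum of all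
   ['chi_j], which is the regular character; [m k 0] stands for the common value of row [k]. *)
have [/existsP[k /existsP[j1 /existsP[j2 m12]]]|/existsPn m_const] :=
  boolP [exists k, exists j1, exists j2, m k j1 != m k j2]; last first.
  case/cfReg_multipleP: nreg.
  have /intrP[z zE] : \sum_k m k 0 * 'chi_k 1%g \is a Num.int.
    by rewrite rpred_sum // => k _; rewrite rpredM ?intr_nat ?Cnat_irr1.
  exists z; rewrite -zE cfReg_sum scaler_sumr phiE linear_sum /=.
  under eq_bigr do rewrite linear_sum.
  rewrite exchange_big; apply: eq_bigr => j _; rewrite chi1 scale1r scaler_suml.
  apply: eq_bigr => k _; rewrite linearZ /= cfDprod_Resl scalerA.
  by have /existsPn/(_ j)/existsPn/(_ 0)/negPn/eqP-> := m_const k.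
rewrite norm_phi normK mulr_sumr (bigD1 k) //= [leRHS](bigD1 k) //= addrA.
apply: lerD; first by rewrite -(card_Iirr_abelian abH); apply: sqr_sum_le_nonconst m12.
apply: ler_sum => l _; rewrite -(card_Iirr_abelian abH); exact: sqr_sum_le.
Qed.

(** * Counting characters by column orthogonality *)

Lemma card_not_cfReg_multiple_dprod (gT : finGroupType) (G H K D : {group gT})
    (HxK : H \x K = D) (sDG : D \subset G) (prH : prime #|H|) :
  (#|[set i : Iirr G | ~~ cfReg_multiple ('Res[H] 'chi_i)]| * (#|H|.-1 * #|K|)
     <= \sum_(z in D :\: K) #|'C_G[z]|)%N.
Proof.
have [_ /mulG_sub[sHD sKD] _ _] := dprodP HxK.
set B := [set i | _].
have le_chi i : i \in B ->
    (#|H|.-1 * #|K|)%:R <= \sum_(z in D :\: K) `|'chi[G]_i z| ^+ 2.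
  rewrite inE => nreg; have Nchi := cfRes_char D (irr_char i).
  have:= cfnorm_not_cfReg_multiple HxK prH Nchi.
  rewrite !cfResRes // => /(_ nreg).
  have sum_norm (A : {group gT}) (phi : 'CF(A)) :
      \sum_(z in A) `|phi z| ^+ 2 = #|A|%:R * '[phi].
    by rewrite (cfnormE (cfun_onG _)) mulVKf ?neq0CG.
  (* Scaling by [#|K|] turns the norms into sums of [|chi z|^2] over [D], as [#|H| #|K| = #|D|], and
     over [K]; their difference is the sum over [D :\: K]. *)
  rewrite -(ler_pM2l (gt0CG K)) mulrDr [leRHS]mulrA -!natrM.
  rewrite (mulnC #|K| #|H|).
  rewrite (dprod_card HxK) -!sum_norm -lerBrDr mulnC => /le_trans-> //.
  rewrite lerBlDr (big_setID K) /= (setIidPr sKD) addrC.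
  apply: lerD; apply: ler_sum => z; first by case/setDP=> Dz _; rewrite cfResE.
  by move=> Kz; rewrite !cfResE ?(subset_trans sKD) ?(subsetP sKD).
rewrite -(ler_nat algC) natrM natr_sum.
apply: le_trans (_ : \sum_(i in B) \sum_(z in D :\: K) `|'chi[G]_i z| ^+ 2 <= _).
  by rewrite mulr_natl -sumr_const ler_sum.
(* Passing to all irreducible characters adds nonnegative terms and makes column orthogonality
   available. *)
apply: le_trans (_ : \sum_i \sum_(z in D :\: K) `|'chi[G]_i z| ^+ 2 <= _).
  rewrite [leRHS](bigID [in B]) /= lerDl sumr_ge0 // => i _.
  by apply: sumr_ge0 => z _; rewrite exprn_ge0.
rewrite exchange_big; apply: ler_sum => z /setDP[/(subsetP sDG) Gz _].
under eq_bigr do rewrite normCK.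
by rewrite second_orthogonality_relation ?class_refl.
Qed.

(** Each nontrivial [h] in [<[x]>] generates [<[x]>], so the centralizer of [h * c] does not depend
    on [h]. The sum over the products [h * c] is thus [#[x].-1] times a sum over [K], and this
    factor cancels. *)
Lemma card_not_cfReg_multiple (gT : finGroupType) (G K : {group gT}) (x : gT)
    (Gx : x \in G) (prx : prime #[x]) (cxK : K \subset 'C_G[x])
    (coKx : coprime #|K| #[x]) :
  (#|[set i : Iirr G | ~~ cfReg_multiple ('Res[<[x]>] 'chi_i)]| * #|K|
     <= \sum_(c in K) #|'C_G[x] :&: 'C[c]|)%N.
Proof.
have [sKG cKx] := subsetIP cxK.
have tiHK : <[x]> :&: K = 1%g by rewrite coprime_TIg // coprime_sym.
have HxK : <[x]> \x K = <[x]> <*> K by rewrite dprodEY ?cent_cycle.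
have [_ defD cKH _] := dprodP HxK.
have sDG : <[x]> <*> K \subset G by rewrite join_subG cycle_subG Gx.
have := card_not_cfReg_multiple_dprod HxK sDG prx.
have -> : (<[x]> <*> K) :\: K = (fun u => u.1 * u.2)%g @: setX <[x]>^# K.
  apply/setP=> z; apply/setDP/imsetP=> [[Dz nKz]|[[h c]]]; last first.
    rewrite !inE /= => /andP[/andP[nh1 xh] Kc] ->; rewrite -defD mem_mulg //.
    split=> //; rewrite groupMr //; apply: contra nh1 => Kh.
    by rewrite -in_set1 -set1gE -tiHK inE xh.
  move: Dz; rewrite -defD => /mulsgP[h c xh Kc def_z]; exists (h, c) => //.
  rewrite !inE /= xh Kc !andbT; apply: contra nKz => /eqP h1.
  by rewrite def_z h1 mul1g.
rewrite big_imset /=; last first.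
  move=> [h c] [h' c'] /setXP[/= /setD1P[_ xh] Kc] /setXP[/= /setD1P[_ xh'] Kc'].
  move=> eq_hc; have Dhc : (h * c)%g \in (<[x]> <*> K)%G by rewrite -defD mem_mulg.
  have [h1 [c1 [_ _ _ uniq_hc]]] := mem_dprod HxK Dhc.
  have [-> ->] := uniq_hc _ _ xh Kc (erefl _).
  by have [-> ->] := uniq_hc _ _ xh' Kc' eq_hc.
rewrite (eq_bigl (fun u => (u.1 \in <[x]>^#) && (u.2 \in K))); last first.
  by move=> [h c]; rewrite in_setX.
rewrite -(pair_big [in <[x]>^#] [in K] (fun h c => #|'C_G[h * c]|)) /=.
rewrite (eq_bigr (fun _ => \sum_(c in K) #|'C_G[x] :&: 'C[c]|)%N); last first.
  move=> h /setD1P[nh1 xh]; apply: eq_bigr => c Kc.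
  have gen_h : <[h]> = <[x]>.
    apply/eqP; rewrite eqEcard cycle_subG xh /=.
    have /primeP[_ /(_ _ (order_dvdG xh))] := prx.
    by rewrite order_eq1 (negPf nh1) -!orderE => /eqP->.
  congr #|pred_of_set _|; rewrite -setIA; congr (_ :&: _).
  have [xh' xKc] := (subsetP cKH c Kc, order_dvdG Kc).
  (* As [h] and [c] commute and have coprime orders, [<[h * c]>] is the product of [<[h]>] and
     [<[c]>]. *)
  rewrite -!cent_cycle -gen_h -centM -cycleM //.
    by apply/commute_sym/cent1P; rewrite -cent_cycle gen_h.
  by rewrite !orderE gen_h coprime_sym (coprime_dvdl xKc).
rewrite sum_nat_const.
have -> : #|<[x]>^#| = #[x].-1 by rewrite [#[x]](cardsD1 1%g) group1.
by rewrite mulnCA leq_pmul2l // -ltnS prednK ?prime_gt1 ?order_gt0.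
Qed.

(** * Class sums, and centralizers in a semidirect product *)

Lemma sum_transversal_classes (gT : finGroupType) (G : {group gT})
    (X : {set gT}) (trX : is_transversal X (classes G) G) (f : gT -> nat)
    (fJ : {in G &, forall x y, f (x ^ y)%g = f x}) :
  (\sum_(x in G) #|'C_G[x]| * f x = #|G| * \sum_(x in X) f x)%N.
Proof.
have /and3P[_ tiG _] := classes_partition G.
rewrite (set_partition_big _ (classes_partition G)) /=.
rewrite -(pblock_transversal trX) big_imset /=; last exact: pblock_inj trX.
rewrite big_distrr /=; apply: eq_bigr => x /(subsetP (transversal_sub trX)) Gx.
rewrite (def_pblock tiG (mem_classes Gx) (class_refl G x)).
(* The class of [x] has [#|G : 'C_G[x]|] elements, each contributing [#|'C_G[x]| * f x]. *)
rewrite -(Lagrange (subsetIl G 'C[x])) index_cent1 mulnAC mulnC -sum_nat_const.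
apply: eq_bigr => _ /imsetP[y Gy ->]; rewrite fJ //; congr (_ * _)%N.
by rewrite -[in LHS](conjGid Gy) cent1J -conjIg cardJg.
Qed.

(** Write an element of the left-hand side as [w = u g]. As [R] is abelian, [w] moves [v] as [g]
    does, so [g] fixes [v]. Conjugation by [c] preserves both factors, so by uniqueness of the
    decomposition [c] fixes [u] and commutes with [g]. *)
Lemma card_subcent_sdpair (aT rT : finGroupType) (D : {group aT})
    (R : {group rT}) (to : groupAction D R) (abR : abelian R) (v : rT)
    (Rv : v \in R) (c : aT) (Dc : c \in D) :
  (#|'C[sdpair1 to v] :&: 'C[sdpair2 to c]|
     <= #|'C_('C_D[v | to])[c]| * #|'Fix_(R | to)[c]|)%N.
Proof.
rewrite mulnC -cardsX.
apply: leq_trans (leq_imset_card (fun u => sdpair1 to u.1 * sdpair2 to u.2)%g _).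
apply/subset_leq_card/subsetP=> w /setIP[/cent1P cvw /cent1P ccw].
have: w \in [set: sdprod_by to] by [].
case/(mem_sdprod (sdprod_sdpair to)) => y [z [/morphimP[u _ Ru ->]]].
case/morphimP=> g _ Dg -> def_w uniq_w.
apply/imsetP; exists (u, g) => //.
have inj1 := injmP (injm_sdpair1 to); have inj2 := injmP (injm_sdpair2 to).
have vg : to v g = v.
  apply: inj1; rewrite ?gact_stable //.
  rewrite /= sdpair_act //.
  have: (sdpair1 to v ^ w = sdpair1 to v)%g by apply/conjg_fixP/commgP.
  by rewrite def_w conjgM -morphJ // [(v ^ u)%g]conjgE (centsP abR v Rv u Ru) mulKg.
have : (w ^ sdpair2 to c = w)%g by apply/conjg_fixP/commgP/commute_sym.
rewrite {1}def_w conjMg -sdpair_act // -morphJ // => /esym/uniq_w[].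
- by rewrite mem_morphim ?gact_stable.
- by rewrite mem_morphim ?groupJ.
move=> /inj1 uc /inj2 gc.
have {}uc : to u c = u by apply: uc; rewrite ?gact_stable.
have {}gc : (g ^ c = g)%g by apply: gc; rewrite ?groupJ.
rewrite in_setX in_setI Ru /= in_setI.
apply/and3P; split; first exact/afix1P.
  by rewrite in_setI Dg !inE Dg sub1set inE /= vg.
exact/cent1P/commgP/conjg_fixP.
Qed.

(** This settles [v = 0]: the regular character of the trivial group takes the value 1, so the
    multiple is the degree of [phi]. *)
Lemma cfReg_multiple1 (gT : finGroupType) (H : {group gT}) (phi : 'CF(H))
    (H1 : H :=: 1%g) (Nphi : phi \is a character) : cfReg_multiple phi.
Proof.
apply/cfReg_multipleP; have /intrP[m phi1] := intr_nat (Cnat_char1 Nphi).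
exists m; apply/cfun_inP=> x Hx; have /set1P-> : x \in [1 gT] by rewrite -H1.
by rewrite phi1 cfunE cfRegE eqxx H1 cards1 mulr1.
Qed.

(** The action of [y] carries fixed points of [x] to fixed points of [x ^ y]; the inverse of [y]
    gives the reverse inequality. *)
Lemma card_afix1J (aT : finGroupType) (D : {group aT}) (rT : finType)
    (to : action D rT) :
  {in D &, forall x y, #|'Fix_to[(x ^ y)%g]| = #|'Fix_to[x]|}.
Proof.
have leJ x y : x \in D -> y \in D -> (#|'Fix_to[x]| <= #|'Fix_to[(x ^ y)%g]|)%N.
  move=> Dx Dy; rewrite -(card_setact to _ y).
  apply/subset_leq_card/subsetP=> _ /imsetP[u /afix1P fixu ->]; apply/afix1P.
  by rewrite -actMin ?groupJ // -conjgC actMin // fixu.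
move=> x y Dx Dy; apply/eqP; rewrite eqn_leq leJ // andbT.
by rewrite -{2}(conjgK y x) leJ ?groupJ ?groupV.
Qed.

Theorem theoremA (p : nat) (F : finFieldType) (charF : p \in [pchar F])
    (gT : finGroupType) (G : {group gT}) (n : nat)
    (rG : mx_representation F G n) (v : 'rV[F]_n)
    (C : {group gT}) (defC : C :=: 'C_G[v | 'MR rG])
    (coCV : coprime #|C| #|[set: 'rV[F]_n]|)
    (X : {set gT}) (reprX : is_transversal X (classes C) C) :
  (#|[set i : Iirr [set: affine_sdprod rG] |
       ~~ cfReg_multiple ('Res[<[sdvec rG v]>] 'chi_i)]|
     <= \sum_(c in X) #|'Fix_('MR rG)([set c])|)%N.
Proof.
pose to := mx_repr_groupAction rG.
have [v0 | nv0] := eqVneq v 0.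
  rewrite (_ : [set i | _] = set0) ?cards0 //; apply/setP=> i; rewrite !inE.
  apply/negbTE; rewrite negbK cfReg_multiple1 ?cfRes_char ?irr_char //=.
  by rewrite v0 /sdvec morph1 cycle1.
have sCG : C \subset G by rewrite defC subsetIl.
have ov : #[v] = p.
  apply: nt_prime_order nv0; first exact: pcharf_prime charF.
  by rewrite FinRing.zmodXgE -scaler_nat (pcharf0 charF) scale0r.
have ox : #[sdvec rG v] = p by rewrite order_injm ?injm_sdpair1 ?inE.
have inj2 := injm_sdpair2 to.
(* The copy of [C] in the semidirect product centralizes [sdvec rG v] because [C] fixes [v]; its
   order is prime to [p] because [p = #[v]] divides the order of the module. *)
pose K := (sdpair2 to @* C)%G.
have cardK : #|K| = #|C| by rewrite card_injm.
have fixC c : c \in C -> mx_repr_act rG v c = v.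
  by rewrite defC => /setIP[_ /astab_act->] //; rewrite set11.
have cxK : K \subset 'C_[set: affine_sdprod rG][sdvec rG v].
  rewrite setTI; apply/subsetP=> _ /morphimP[c Gc Cc ->].
  apply/cent1P/commute_sym/commgP/conjg_fixP.
  apply: etrans (esym (sdpair_act to (in_setT v) Gc)) _.
  by rewrite /= fixC.
have coKx : coprime #|K| #[sdvec rG v].
  rewrite cardK ox -ov (coprime_dvdr _ coCV) // order_dvdG ?inE //.
have := card_not_cfReg_multiple (in_setT _) _ cxK coKx.
rewrite ox (pcharf_prime charF) => /(_ isT).
rewrite cardK mulnC => le_sum.
(* After multiplication by [#|C|], the sum over representatives becomes the sum over all [c] in [C]
   of [|C_C(c)| |C_V(c)|], which is compared term by term. *)
rewrite -(leq_pmul2l (cardG_gt0 C)); apply: leq_trans le_sum _.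
rewrite -(sum_transversal_classes reprX); last first.
  move=> x y Cx Cy /=.
  by rewrite card_afix1J ?(subsetP sCG).
rewrite /= morphimEsub // big_imset /=; last first.
  by move=> x y /(subsetP sCG) Gx /(subsetP sCG) Gy; apply: (injmP inj2).
apply: leq_sum => c Cc; rewrite setTI.
have Gc := subsetP sCG c Cc.
have := card_subcent_sdpair to _ (in_setT v) Gc.
rewrite -defC setTI; apply; apply: FinRing.zmod_abelian.
Qed.
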